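(* Let $n\ge2$, let $q$ be a power of the prime $p$, and consider type $A_{n-1}$ (that is, $G=SL_n$ with split Frobenius map $F$ over $F_q$, $G^F=SL(n,q)$, $W=S_n$). For each $F$-stable point $v\in\bar A_{p'}$, there is a unique shortest $w\in W$ such that $F(v)=wv+y$ for some $y\in Y$. Moreover, letting $c$ be the semisimple conjugacy class of $G^F$ corresponding to $v$, the conjugacy class of $w$ is $\Phi(c)$.
   Context: $Y=\{y\in\mathbb{Z}^n:\sum y_i=0\}$ is the coroot lattice and $W=S_n$ acts on $Y\otimes\mathbb{R}=\{v\in\mathbb{R}^n:\sum v_i=0\}$ by $w e_i=e_{w(i)}$. The affine Weyl group $\langle Y,W\rangle$ is generated by $W$ and the translations by $Y$. Its fundamental region is $\bar A=\{v\in Y\otimes\mathbb{R}: v_1\ge v_2\ge\dots\ge v_n,\ v_1-v_n\le1\}$, and each element of $Y\otimes\mathbb{R}$ is equivalent under $\langle Y,W\rangle$ to exactly one element of $\bar A$. Let $\mathbb{Q}_{p'}$ be the additive group of rational numbers $s/t$ with $s,t\in\mathbb{Z}$ and $p\nmid t$, and $\bar A_{p'}=\bar A\cap(Y\otimes\mathbb{Q}_{p'})$. $F$ acts on $Y\otimes\mathbb{R}$ as multiplication by $q$, $F(v)=qv$, and this induces an action on $\bar A_{p'}$ sending $v$ to the unique element of $\bar A$ equivalent to $F(v)$ under $\langle Y,W\rangle$; $v$ is $F$-stable if it is fixed by this action. The length of $w\in S_n$ is its number of inversions. Correspondence: fix an isomorphism $\psi:\mathbb{Q}_{p'}/\mathbb{Z}\to\overline{F_q}^{\,*}$.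 The $q^{n-1}$ $F$-stable points of $\bar A_{p'}$ correspond bijectively to the semisimple conjugacy classes of $SL(n,q)$: $v=(v_1,\dots,v_n)$ corresponds to the class with eigenvalues $\psi(v_1),\dots,\psi(v_n)$. The map $\Phi$: if the characteristic polynomial of $c$ factors over $F_q$ as $\prod_i f_i^{a_i}$ with $f_i$ distinct monic irreducible of degree $d_i$, then $\Phi(c)$ is the conjugacy class of $S_n$ whose cycle type is the partition in which $d_i$ is repeated $a_i$ times for each $i$. *)

(* Defs.v *)
From HB Require Import structures.
From mathcomp Require Import all_boot all_order all_algebra all_fingroup all_field.
From mathcomp Require Import reals.

Set Implicit Arguments.
Unset Strict Implicit.
Unset Printing Implicit Defensive.

Import Order.TTheory GRing.Theory Num.Theory.
Local Open Scope ring_scope.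

(* Y (x) R is the hyperplane of sum-zero vectors in R^n, and Y (x) Q_p' its
   subgroup of vectors with all coordinates in Q_p'.  Coordinates are numbered
   from 0 to n - 1. *)

Definition corootY n (y : 'rV[int]_n) : Prop := \sum_i y 0 i = 0.

(* w e_i = e_(w i), so the coordinate of w v at w i is the one of v at i. *)
Definition Wact (R : realType) n (w : 'S_n) (v : 'rV[R]_n) : 'rV[R]_n :=
  \sum_i v 0 i *: delta_mx 0 (w i).

Definition Ytrans (R : realType) n (y : 'rV[int]_n) (v : 'rV[R]_n) : 'rV[R]_n :=
  v + map_mx intr y.

(* Equivalence under the group <Y, W>: the set of generators is closed under
   inverses, so the orbits are reached by composing generators only. *)
Inductive affW_equiv (R : realType) n (u : 'rV[R]_n) : 'rV[R]_n -> Prop :=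
  | affW_refl : affW_equiv u u
  | affW_W (w : 'S_n) v : affW_equiv u v -> affW_equiv u (Wact w v)
  | affW_Y (y : 'rV[int]_n) v :
      corootY y -> affW_equiv u v -> affW_equiv u (Ytrans y v).

Definition in_Abar (R : realType) n (v : 'rV[R]_n) : Prop :=
  [/\ \sum_i v 0 i = 0,
      forall i j : 'I_n, (i <= j)%N -> v 0 j <= v 0 i
    & forall i j : 'I_n, i = 0%N :> nat -> j = n.-1 :> nat -> v 0 i - v 0 j <= 1].

Definition in_Qp' (R : realType) (p : nat) (x : R) : Prop :=
  exists s t : int, ~~ (p%:Z %| t)%Z /\ x = s%:~R / t%:~R.

Definition in_Abar_p' (R : realType) (p : nat) n (v : 'rV[R]_n) : Prop :=
  in_Abar v /\ forall i, in_Qp' p (v 0 i).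

Definition Fact (R : realType) (q : nat) n (v : 'rV[R]_n) : 'rV[R]_n := q%:R *: v.

(* Graph of the action induced by F on the fundamental region. *)
Definition induced_F (R : realType) (q : nat) n (v u : 'rV[R]_n) : Prop :=
  in_Abar u /\ affW_equiv (Fact q v) u.

Definition F_stable (R : realType) (q : nat) n (v : 'rV[R]_n) : Prop :=
  induced_F q v v.

Definition perm_length n (w : 'S_n) : nat :=
  #|[set ij : 'I_n * 'I_n | (ij.1 < ij.2)%N && (w ij.2 < w ij.1)%N]|.

Definition carries (R : realType) (q : nat) n (v : 'rV[R]_n) (w : 'S_n) : Prop :=
  exists2 y : 'rV[int]_n, corootY y & Fact q v = Wact w v + map_mx intr y.

Definition shortest_carrying (R : realType) (q : nat) n (v : 'rV[R]_n) (w : 'S_n) : Prop :=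
  carries q v w /\ forall w', carries q v w' -> (perm_length w <= perm_length w')%N.

(* psi induces an isomorphism from Q_p' / Z onto the multiplicative group of L;
   its values outside Q_p' are irrelevant. *)
Record iso_Qp'_mod_Z (R : realType) (p : nat) (L : fieldType) (psi : R -> L) : Prop := {
  psi_neq0 : forall x, in_Qp' p x -> psi x != 0;
  psiD : forall x y, in_Qp' p x -> in_Qp' p y -> psi (x + y) = psi x * psi y;
  psi_ker : forall x, in_Qp' p x -> (psi x = 1 <-> exists m : int, x = m%:~R);
  psi_onto : forall z, z != 0 -> exists2 x, in_Qp' p x & psi x = z
}.

Definition algebraic_closure_of (Fq : fieldType) (L : closedFieldType)
  (iota : {rmorphism Fq -> L}) : Prop := forall z : L, algebraicOver iota z.

Definition SL (Fq : finFieldType) n : {set 'M[Fq]_n} := [set g | \det g == 1].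

Definition SLclass (Fq : finFieldType) n (g : 'M[Fq]_n) : {set 'M[Fq]_n} :=
  [set h *m g *m invmx h | h in SL Fq n].

Definition semisimple (Fq : finFieldType) (L : closedFieldType)
  (iota : {rmorphism Fq -> L}) n (g : 'M[Fq]_n) : Prop :=
  diagonalizable (map_mx iota g).

Definition semisimple_class (Fq : finFieldType) (L : closedFieldType)
  (iota : {rmorphism Fq -> L}) n (c : {set 'M[Fq]_n}) : Prop :=
  exists g, [/\ g \in SL Fq n, semisimple iota g & c = SLclass g].

(* Equality of characteristic polynomials expresses that the eigenvalues of the
   class are the psi (v_i), counted with multiplicity. *)
Definition corresponds (R : realType) (Fq : finFieldType) (L : closedFieldType)
  (iota : {rmorphism Fq -> L}) (psi : R -> L) n
  (v : 'rV[R]_n) (c : {set 'M[Fq]_n}) : Prop :=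
  semisimple_class iota c /\
  forall g, g \in c ->
    char_poly (map_mx iota g) = \prod_i ('X - (psi (v 0 i))%:P).

Definition cycle_type n (w : 'S_n) : seq nat :=
  [seq #|(C : {set _})| | C <- enum (porbits w)].

(* fs lists the pairs (f_i, a_i). *)
Definition is_factorization (Fq : fieldType) (h : {poly Fq})
  (fs : seq ({poly Fq} * nat)) : Prop :=
  [/\ uniq (unzip1 fs),
      forall fa, fa \in fs ->
        [/\ fa.1 \is monic, irreducible_poly fa.1 & (0 < fa.2)%N]
    & h = \prod_(fa <- fs) fa.1 ^+ fa.2].

(* d_i = (size f_i).-1 repeated a_i times, as an unordered list. *)
Definition factor_partition (Fq : fieldType) (fs : seq ({poly Fq} * nat)) : seq nat :=
  flatten [seq nseq fa.2 (size fa.1).-1 | fa : {poly Fq} * nat <- fs].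

(* Graph of Phi: K is the conjugacy class of S_n with the prescribed cycle type. *)
Definition is_Phi (Fq : finFieldType) n (c : {set 'M[Fq]_n}) (K : {set 'S_n}) : Prop :=
  exists fs : seq ({poly Fq} * nat),
    [/\ forall g, g \in c -> is_factorization (char_poly g) fs,
        K \in classes [set: 'S_n]
      & forall s, s \in K -> perm_eq (cycle_type s) (factor_partition fs)].

(* Main.v *)
From HB Require Import structures.
Require Import Defs.
From mathcomp Require Import all_boot all_order all_algebra all_fingroup all_field.
From mathcomp Require Import reals zify.

Set Implicit Arguments.
Unset Strict Implicit.
Unset Printing Implicit Defensive.

Import Order.TTheory GRing.Theory Num.Theory.
Local Open Scope ring_scope.

(** Put lam i = psi (v_i).  Since psi has kernel Z on Q_p', the condition
    F v = w v + y for some y in Y says exactly that lam (w i) ^+ q = lam i for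
    every i: the permutation w inverts the Frobenius x |-> x ^+ q on the family
    of eigenvalues lam.  Such a w exists because v is F-stable, and everything
    else is a statement about the permutations w that invert an injective map
    phi on a family lam.

    The fibres of lam are the sets of indices with a common eigenvalue, and all
    the candidates w map a given fibre onto the same fibre.  If w had an
    inversion inside a fibre, swapping the two values would give a candidate
    with fewer inversions ([perm_length_swap]); hence a shortest candidate is
    increasing on each fibre ([shortest_lift_increasing]).  There is only one
    increasing bijection between two finite sets of indices, whence uniqueness
    ([increasing_lift_uniq]).  For the same reason, a power of the shortest w
    which maps a fibre to itself is the identity on that fibre
    ([increasing_lift_return]): lam is injective on each cycle of w.

    So the eigenvalues along a cycle C of w form one Frobenius orbit, without
    repetition.  The product of the X - lam i for i in C is therefore fixed by
    Frobenius, descends to Fq, and is irreducible of degree #|C| there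
    ([map_orbit_poly], [orbit_poly_irreducible]).  The characteristic polynomial
    of the class is the product of these polynomials over the cycles of w, so
    its irreducible factors, listed with multiplicity, have as degrees the
    lengths of the cycles of w: this is the equality of w's conjugacy class with
    the image of the class under Phi. *)

(** * Inversions and increasing permutations *)

(** The map f below sends an inversion of the swapped permutation to an
    inversion of w: it moves both places by the transposition, unless this would
    reverse their order.  It is injective and misses the inversion (i, j). *)
Lemma perm_length_swap n (w : 'S_n) (i j : 'I_n) :
  (i < j)%N -> (w j < w i)%N -> (perm_length (tperm i j * w)%g < perm_length w)%N.
Proof.
move=> ltij ltw; rewrite /perm_length.
set A := [set ij | _]; set B := [set ij | _]; set t := tperm i j.
pose f (ab : 'I_n * 'I_n) := if (t ab.1 < t ab.2)%N then (t ab.1, t ab.2) else ab.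
have f_inj : {in A &, injective f}.
  move=> [a b] [a' b'] /[!inE] /= /andP[ltab _] /andP[ltab' _]; rewrite /f /=.
  case: ifP => h; case: ifP => h' [].
  - by move=> /perm_inj -> /perm_inj ->.
  - by move=> e1 e2; move: h'; rewrite -e1 -e2 !tpermK ltab.
  - by move=> e1 e2; move: h; rewrite e1 e2 !tpermK ltab'.
  - by move=> -> ->.
have ijB : (i, j) \in B by rewrite inE /= ltij.
(* As (i, j) is an inversion of w, it is enough that f maps into the other ones. *)
rewrite -(card_in_imset f_inj) (cardsD1 (i, j) B) ijB add1n ltnS.
apply/subset_leq_card/subsetP => _ /imsetP[[a b] + ->].
rewrite !inE /f /= !permM -/t => /andP[ltab].
case: ifP => /=; rewrite xpair_eqE.
  (* Here (t a, t b) = (i, j) would force (a, b) = (j, i), against a < b. *)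
  move=> lt ->; rewrite lt !andbT; apply/andP => -[/eqP ta /eqP tb].
  by move: ltab; rewrite -(tpermK i j a) -(tpermK i j b) -/t ta tb tpermL tpermR; lia.
(* The swap reverses the order of a < b only if one of them is i or j and both
   lie between i and j. *)
rewrite ltab -!val_eqE /= /t; move: ltab.
have val_neq (x y : 'I_n) : x <> y -> x <> y :> nat by move=> + /val_inj.
by case: (tpermP i j a) => [->|->|/val_neq + /val_neq +];
  case: (tpermP i j b) => [->|->|/val_neq + /val_neq +]; lia.
Qed.

(** If w moved i upwards (or downwards), the sequence of the w^k i would be
    strictly monotone, yet it returns to i at the order of w. *)
Lemma increasing_on_fixed n (w : 'S_n) (A : {pred 'I_n}) (i : 'I_n) :
    {in A, forall j, w j \in A} ->
    {in A &, forall j k : 'I_n, (j < k)%N -> (w j < w k)%N} ->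
  i \in A -> w i = i.
Proof.
move=> wA w_incr Ai; have Ak k : (w ^+ k)%g i \in A.
  by elim: k => [|k IHk]; rewrite ?expg0 ?perm1 // expgSr permM wA.
have fix_order : (w ^+ #[w])%g i = i by rewrite expg_order perm1.
case: (ltngtP (w i) i) => [lt_wi | lt_iw | /val_inj //].
  suff lt k : ((w ^+ k.+1)%g i < i)%N.
    by have := lt (#[w]%g).-1; rewrite prednK ?order_gt0 // fix_order ltnn.
  elim: k => [|k IHk]; first by rewrite expg1.
  rewrite expgSr permM; apply: ltn_trans lt_wi.
  exact: w_incr.
suff lt k : (i < (w ^+ k.+1)%g i)%N.
  by have := lt (#[w]%g).-1; rewrite prednK ?order_gt0 // fix_order ltnn.
elim: k => [|k IHk]; first by rewrite expg1.
by rewrite expgSr permM; apply: ltn_trans lt_iw _; apply: w_incr.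
Qed.

(** * Permutations that invert a map on a family *)

Section Lifts.
Variables (T : eqType) (phi : T -> T) (n : nat) (lam : 'I_n -> T).
Hypothesis phi_inj : injective phi.

(** A boolean predicate, so that a shortest such w can be picked among the finitely
    many permutations. *)
Definition lifts (w : 'S_n) := [forall i, phi (lam (w i)) == lam i].

Definition increasing_on_fibres (w : 'S_n) :=
  forall i j : 'I_n, lam i = lam j -> (i < j)%N -> (w i < w j)%N.

Lemma liftsP (w : 'S_n) : reflect (forall i, phi (lam (w i)) = lam i) (lifts w).
Proof. exact: 'forall_eqP. Qed.

(** Swapping the values of w at two places of one fibre keeps it a lift, since
    the condition on w at i depends on lam i only. *)
Lemma shortest_lift_increasing w :
    lifts w -> (forall w', lifts w' -> (perm_length w <= perm_length w')%N) ->
  increasing_on_fibres w.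
Proof.
move=> /liftsP w_lift w_min i j eq_lam ltij; rewrite ltnNge; apply/negP => le_wji.
have lt_wji : (w j < w i)%N.
  rewrite ltn_neqAle le_wji andbT val_eqE (inj_eq perm_inj).
  by apply: contraTneq ltij => ->; rewrite ltnn.
have := w_min (tperm i j * w)%g; rewrite leqNgt perm_length_swap // => /implyP.
rewrite implybF => /negP; apply; apply/liftsP => k.
by rewrite permM w_lift; case: tpermP => // ->.
Qed.

(** The permutation u with w = w' u preserves each fibre and is increasing there,
    hence is the identity. *)
Lemma increasing_lift_uniq w w' :
    lifts w -> lifts w' -> increasing_on_fibres w -> increasing_on_fibres w' ->
  w = w'.
Proof.
move=> /liftsP lw /liftsP lw' iw iw'; apply/permP => i.
pose u := (w * w'^-1)%g.
have wu k : w k = w' (u k) by rewrite /u permM permKV.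
have lam_u k : lam (u k) = lam k by rewrite -lw' -wu lw.
rewrite wu; congr (w' _).
apply: (@increasing_on_fixed _ _ [pred j | lam j == lam i]); last by rewrite inE.
  by move=> j; rewrite !inE lam_u.
move=> j k /eqP ej /eqP ek ltjk.
have eq_u : lam (u k) = lam (u j) by rewrite !lam_u ej ek.
have := iw j k (etrans ej (esym ek)) ltjk; rewrite !wu.
case: (ltngtP (u j) (u k)) => [//|lt|/val_inj ->]; last by rewrite ltnn.
by have := iw' _ _ eq_u lt; lia.
Qed.

(** A lift maps fibres into fibres because phi is injective.  So w^k is increasing
    on the fibre of i, which it maps to itself as soon as it does so for the one
    point i. *)
Lemma increasing_lift_return (w : 'S_n) k i :
    lifts w -> increasing_on_fibres w ->
  lam ((w ^+ k)%g i) = lam i -> (w ^+ k)%g i = i.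
Proof.
move=> /liftsP lw iw ret.
have lam_wX m a b : lam a = lam b -> lam ((w ^+ m)%g a) = lam ((w ^+ m)%g b).
  move=> eq_ab; elim: m => [|m IHm]; first by rewrite expg0 !perm1.
  by rewrite expgSr !permM; apply: phi_inj; rewrite !lw.
apply: (@increasing_on_fixed _ _ [pred j | lam j == lam i]); last by rewrite inE.
  by move=> j /eqP ej; rewrite inE (lam_wX _ _ _ ej) ret.
move=> a b /eqP ea /eqP eb ltab.
elim: k {ret} => [|m IHm]; first by rewrite expg0 !perm1.
by rewrite expgSr !permM iw //; apply: lam_wX; rewrite ea.
Qed.

End Lifts.

(** * Cycle types of conjugate permutations *)

Lemma porbit_conjg (T : finType) (w u : {perm T}) x :
  porbit (w ^ u)%g (u x) = u @: porbit w x.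
Proof.
have E k : ((w ^ u) ^+ k)%g (u x) = u ((w ^+ k)%g x) by rewrite -conjXg permJ.
apply/setP => y; apply/porbitP/imsetP => [[k ->]|[_ /porbitP[k ->] ->]].
  by rewrite E; exists ((w ^+ k)%g x); rewrite ?mem_porbit.
by exists k; rewrite E.
Qed.

Lemma cycle_type_conjg n (w u : 'S_n) :
  perm_eq (cycle_type (w ^ u)%g) (cycle_type w).
Proof.
have U_inj : injective (fun C : {set 'I_n} => u @: C) by apply/imset_inj/perm_inj.
have -> : cycle_type w = map (fun C : {set 'I_n} => #|C|)
    (map (fun C : {set 'I_n} => u @: C) (enum (porbits w))).
  by rewrite -map_comp; apply: eq_map => C /=; rewrite card_imset //; apply: perm_inj.
apply/perm_map/uniq_perm; rewrite ?map_inj_uniq ?enum_uniq // => C.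
rewrite mem_enum; apply/imsetP/mapP => [[x _ ->]|[D]].
  exists (porbit w ((u^-1)%g x)); last by rewrite -porbit_conjg permKV.
  by rewrite mem_enum imset_f.
rewrite mem_enum => /imsetP[x _ ->] ->.
by exists (u x); rewrite ?porbit_conjg.
Qed.

(** * Descent of orbit polynomials to the finite field *)

Section GaloisDescent.
Variables (Fq : finFieldType) (L : fieldType) (iota : {rmorphism Fq -> L}).

(** The elements of Fq are all the roots of X^q - X, which splits over Fq. *)
Lemma frobenius_fixed (x : L) : x ^+ #|Fq| = x -> exists a, iota a = x.
Proof.
move=> x_fixed; have := congr1 (fun P => (map_poly iota P).[x]) (finField_genPoly Fq).
rewrite rmorphB /= map_polyXn map_polyX !hornerE x_fixed subrr.
rewrite rmorph_prod horner_prod => /esym/eqP/prodf_eq0[a _].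
rewrite rmorphB /= map_polyX map_polyC !hornerE subr_eq0 => /eqP->.
by exists a.
Qed.

(** A partial inverse of iota, 0 outside its range, which turns a polynomial with
    coefficients in the range of iota into one over Fq. *)
Definition descent (x : L) : Fq := odflt 0 [pick a | iota a == x].

Lemma descentK (x : L) : x ^+ #|Fq| = x -> iota (descent x) = x.
Proof.
move=> /frobenius_fixed[a <-]; rewrite /descent.
by case: pickP => [b /eqP|/(_ a)/eqP].
Qed.

(** The power map is additive only in the right characteristic; carrying the proof
    as an argument lets the ring morphism structure attach to the function. *)
Definition frobenius of [pchar L].-nat #|Fq| := fun x : L => x ^+ #|Fq|.

Hypothesis charL : [pchar L].-nat #|Fq|.

Lemma frobenius_is_nmod_morphism : nmod_morphism (frobenius charL).
Proof.
split=> [|x y]; last exact: exprDn_pchar.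
by rewrite /frobenius expr0n gtn_eqF // ltnW ?finNzRing_gt1.
Qed.

Lemma frobenius_is_monoid_morphism : monoid_morphism (frobenius charL).
Proof. by split=> [|x y]; rewrite /frobenius ?expr1n ?exprMn. Qed.

HB.instance Definition _ :=
  GRing.isNmodMorphism.Build L L (frobenius charL) frobenius_is_nmod_morphism.
HB.instance Definition _ :=
  GRing.isMonoidMorphism.Build L L (frobenius charL) frobenius_is_monoid_morphism.

Lemma frobenius_inj : injective (fun x : L => x ^+ #|Fq|).
Proof. exact: (fmorph_inj (frobenius charL)). Qed.

Lemma root_frobenius (f : {poly Fq}) x :
  root (map_poly iota f) x = root (map_poly iota f) (x ^+ #|Fq|).
Proof.
have f_fixed : map_poly (frobenius charL) (map_poly iota f) = map_poly iota f.
  rewrite -map_poly_comp; apply: eq_map_poly => a.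
  by rewrite /= /frobenius -rmorphXn expf_card.
by rewrite -[in RHS]f_fixed -[x ^+ _]/(frobenius charL x) fmorph_root.
Qed.

(* The two hypotheses on s say that the values of lam along a cycle of s form a
   single Frobenius orbit, run through backwards and without repetition. *)
Variables (T : finType) (s : {perm T}) (lam : T -> L).
Hypothesis s_lift : forall i, lam (s i) ^+ #|Fq| = lam i.
Hypothesis s_return :
  forall k i, lam ((s ^+ k)%g i) = lam i -> (s ^+ k)%g i = i.

Definition orbit_poly (C : {set T}) : {poly Fq} :=
  map_poly descent (\prod_(i in C) ('X - (lam i)%:P)).

(** Frobenius permutes the linear factors of the product over a cycle, so the
    coefficients of that product come from Fq. *)
Lemma map_orbit_poly x :
  map_poly iota (orbit_poly (porbit s x)) =
  \prod_(i in porbit s x) ('X - (lam i)%:P).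
Proof.
set P := \prod_(i in _) _.
have P_fixed : map_poly (frobenius charL) P = P.
  rewrite /P rmorph_prod /= (reindex_inj (@perm_inj _ s)) /=.
  apply: eq_big => [i|i _].
    by rewrite -!eq_porbit_mem -[s]expg1 porbit_perm.
  by rewrite rmorphB /= map_polyX map_polyC /= /frobenius s_lift.
apply/polyP => k.
have Pk_fixed : P`_k ^+ #|Fq| = P`_k by rewrite -{2}P_fixed coef_map.
have descent0 : descent 0 = 0.
  apply: (fmorph_inj iota); rewrite rmorph0 descentK //.
  by rewrite -[LHS]/(frobenius charL 0) rmorph0.
rewrite coef_map /= coef_map_id0 //.
exact: descentK.
Qed.

Lemma orbit_poly_monic x : orbit_poly (porbit s x) \is monic.
Proof. by rewrite -(map_monic iota) map_orbit_poly monic_prod_XsubC. Qed.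

Lemma size_orbit_poly x : size (orbit_poly (porbit s x)) = #|porbit s x|.+1.
Proof. 
by rewrite -(size_map_poly iota) map_orbit_poly -big_enum size_prod_XsubC -cardE.
Qed.

(** A nonconstant divisor over Fq has a root lam j with j in the cycle, hence, being
    stable under Frobenius, all the lam i of the cycle as roots.  These are
    distinct, so the divisor has full degree. *)
Lemma orbit_poly_irreducible x : irreducible_poly (orbit_poly (porbit s x)).
Proof.
split=> [|f f_nonconst f_dvd].
  by rewrite size_orbit_poly ltnS lt0n card_porbit_neq0.
rewrite -dvdp_size_eqp // size_orbit_poly eqn_leq.
rewrite -{1}(size_orbit_poly x) dvdp_leq ?monic_neq0 ?orbit_poly_monic //=.
have f_neq0 : f != 0 by apply: dvdpN0 f_dvd _; rewrite monic_neq0 ?orbit_poly_monic.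
have [j Cj root_j] : exists2 j, j \in porbit s x & root (map_poly iota f) (lam j).
  (* Over L the divisor is, up to a unit, a product of some of the factors. *)
  apply/exists_inP.
  move: f_dvd; rewrite -(dvdp_map iota) map_orbit_poly.
  have := f_nonconst; rewrite -(size_map_poly iota).
  rewrite -big_enum => + /dvdp_prod_XsubC[m eq_f].
  have := size_map_poly iota f; have /eqp_size := eq_f => ->.
  rewrite size_prod_XsubC; case E: (mask m _) => [//|j r] _ _.
  apply/exists_inP; exists j.
    by rewrite -mem_enum; apply: (@mem_mask _ _ m); rewrite E mem_head.
  by rewrite (eqp_root eq_f) E big_cons rootM root_XsubC eqxx.
have orbitC i1 i2 : i1 \in porbit s x -> i2 \in porbit s x -> i1 \in porbit s i2.
  by rewrite -!eq_porbit_mem => /eqP-> /eqP->.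
have root_C i : i \in porbit s x -> root (map_poly iota f) (lam i).
  move=> Ci.
  have /porbitP[k jE] := orbitC _ _ Cj Ci.
  (* From j = s^k i, raising lam j to the q-th power k times gives lam i. *)
  move: root_j; rewrite jE; elim: k {jE} => [|k IHk]; first by rewrite expg0 perm1.
  by rewrite expgSr permM root_frobenius s_lift.
have lam_uniq : uniq [seq lam i | i in porbit s x].
  rewrite map_inj_in_uniq ?enum_uniq // => i1 i2; rewrite !mem_enum => C1 C2.
  have /porbitP[k ->] := orbitC _ _ C2 C1; first by move/esym/s_return.
rewrite -(size_map_poly iota) cardE -(size_map lam) max_poly_roots //.
  by rewrite map_poly_eq0.
by apply/allP => _ /mapP[i + ->]; rewrite mem_enum => /root_C.
Qed.

Lemma prod_orbit_poly :
  map_poly iota (\prod_(C in porbits s) orbit_poly C) = \prod_i ('X - (lam i)%:P).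
Proof.
rewrite rmorph_prod /= [RHS](partition_big_imset (porbit s)) /=.
apply: eq_bigr => _ /imsetP[x _ ->]; rewrite map_orbit_poly.
by apply: eq_bigl => i; rewrite -eq_porbit_mem.
Qed.

End GaloisDescent.

(** * Factorizations from lists of irreducible factors *)

(** Distinct cycles may have the same polynomial; counting the occurrences of each
    factor in the list gives the exponents. *)
Lemma is_factorization_tally (F : fieldType) (fs : seq {poly F}) :
    {in fs, forall f, f \is monic /\ irreducible_poly f} ->
  is_factorization (\prod_(f <- fs) f) (tally fs).
Proof.
move=> fsP; have /andP[tally_uniq tally_pos] := tallyP fs; split=> // [fa fa_in|].
  have fa2 : (0 < fa.2)%N.
    by rewrite lt0n; apply: contra tally_pos => /eqP <-; apply: map_f.
  have [] // : fa.1 \is monic /\ irreducible_poly fa.1.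
  apply: fsP; rewrite -(perm_mem (tallyK fs)).
  apply/flatten_mapP; exists fa => //; by rewrite mem_nseq fa2 eqxx.
rewrite -(perm_big _ (tallyK fs)) /= big_flatten big_map.
by apply: eq_bigr => fa _; rewrite big_nseq -Monoid.iteropE.
Qed.

Lemma factor_partition_tally (F : fieldType) (fs : seq {poly F}) :
  perm_eq (factor_partition (tally fs)) [seq (size f).-1 | f : {poly F} <- fs].
Proof.
rewrite -(permPr (perm_map _ (tallyK fs))) map_flatten -map_comp.
by under eq_map do rewrite /= map_nseq.
Qed.

(** * The isomorphism psi on rationals with denominator prime to p *)

Section RationalExponential.
Variables (R : realType) (p : nat) (p_pr : prime p) (L : fieldType) (psi : R -> L).
Hypothesis psi_iso : iso_Qp'_mod_Z p psi.

Lemma in_Qp'_int (m : int) : in_Qp' p (m%:~R : R).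
Proof.
exists m, 1; rewrite divr1; split=> //.
by rewrite dvdz1 /= neq_ltn prime_gt1 ?orbT.
Qed.

Lemma in_Qp'N (x : R) : in_Qp' p x -> in_Qp' p (- x).
Proof. by move=> [a [t [pt ->]]]; exists (- a), t; rewrite mulrNz mulNr. Qed.

Lemma in_Qp'D (x y : R) : in_Qp' p x -> in_Qp' p y -> in_Qp' p (x + y).
Proof.
move=> [a [t [pt ->]]] [b [u [pu ->]]]; exists (a * u + b * t), (t * u); split.
  by rewrite dvdzE abszM Euclid_dvdM // negb_or -!dvdzE pt.
have neq0 z : ~~ (p%:Z %| z)%Z -> z%:~R != 0 :> R.
  by apply: contraNneq => /eqP; rewrite intr_eq0 => /eqP ->; rewrite dvdz0.
by rewrite intrD !intrM addf_div ?neq0.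
Qed.

Lemma in_Qp'Mn k (x : R) : in_Qp' p x -> in_Qp' p (k%:R * x).
Proof.
move=> Qx; elim: k => [|k IHk]; first by rewrite mul0r; apply: (in_Qp'_int 0).
by rewrite -natr1 mulrDl mul1r; apply: in_Qp'D.
Qed.

Lemma psiMn k (x : R) : in_Qp' p x -> psi (k%:R * x) = psi x ^+ k.
Proof.
move=> Qx; elim: k => [|k IHk].
  by rewrite mul0r; apply/(psi_ker psi_iso); [apply: (in_Qp'_int 0) | exists 0].
by rewrite -natr1 mulrDl mul1r (psiD psi_iso) ?IHk ?exprSr //; apply: in_Qp'Mn.
Qed.

Lemma eq_psi (x y : R) : in_Qp' p x -> in_Qp' p y ->
  psi x = psi y <-> exists m : int, x - y = m%:~R.
Proof.
move=> Qx Qy; have Qd : in_Qp' p (x - y) by apply/in_Qp'D/in_Qp'N.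
have psi_x : psi x = psi (x - y) * psi y by rewrite -(psiD psi_iso) ?subrK.
rewrite -(psi_ker psi_iso Qd) psi_x; have y_neq0 := psi_neq0 psi_iso Qy.
split=> [xyE|->]; last by rewrite mul1r.
by apply: (mulIf y_neq0); rewrite mul1r.
Qed.
End RationalExponential.

(** * Affine Weyl group and coordinates *)

Lemma Wact_coord (R : realType) n (w : 'S_n) (v : 'rV[R]_n) i :
  Wact w v 0 (w i) = v 0 i.
Proof.
rewrite /Wact summxE (bigD1 i) //= !mxE !eqxx mulr1 big1 ?addr0 // => j ne_ji.
by rewrite !mxE (inj_eq perm_inj) eq_sym (negPf ne_ji) andbF mulr0.
Qed.

(** Translations disappear modulo Z, so only the Weyl group part of the element
    taking u to v is seen. *)
Lemma affW_equiv_coord (R : realType) n (u v : 'rV[R]_n) :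
    affW_equiv u v ->
  exists w : 'S_n, forall i, exists m : int, u 0 (w i) - v 0 i = m%:~R.
Proof.
elim=> [|w v' _ [w' w'P]|y v' _ _ [w' w'P]].
- by exists 1%g => i; exists 0; rewrite perm1 subrr.
- exists (w^-1 * w')%g => i; have [m mE] := w'P ((w^-1)%g i).
  by exists m; rewrite permM -mE -{2}(permKV w i) Wact_coord.
exists w' => i; have [m mE] := w'P i; exists (m - y 0 i).
by rewrite !mxE opprD addrA mE intrB.
Qed.

(** The integral vector q v - w v has sum zero as soon as v has, so it lies in Y
    automatically. *)
Lemma carriesP (R : realType) q n (v : 'rV[R]_n) (w : 'S_n) :
    \sum_i v 0 i = 0 ->
  carries q v w <-> forall i, exists m : int, q%:R * v 0 (w i) - v 0 i = m%:~R.
Proof.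
move=> v_sum0; split=> [[y _ /rowP qvE] i|/fin_all_exists[m mE]].
  exists (y 0 (w i)); have := qvE (w i); rewrite !mxE Wact_coord => ->.
  by rewrite addrAC subrr add0r.
exists (\row_i m ((w^-1)%g i)).
  apply/eqP; rewrite -(intr_eq0 R) rmorph_sum /= (reindex_inj (@perm_inj _ w)) /=.
  under eq_bigr do rewrite mxE permK -mE.
  rewrite sumrB v_sum0 subr0 -mulr_sumr.
  have <- : \sum_i v 0 i = \sum_i v 0 (w i)
    by rewrite [LHS](reindex_inj (@perm_inj _ w)).
  by rewrite v_sum0 mulr0.
apply/rowP => i; rewrite -(permKV w i) !mxE Wact_coord permK -mE.
by rewrite addrC subrK.
Qed.

(** * The shortest Weyl group element and the map Phi *)

Theorem lemma7 (R : realType) (n p e q : nat)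
    (hn : (2 <= n)%N) (hp : prime p) (he : (0 < e)%N) (hq : q = (p ^ e)%N)
    (Fq : finFieldType) (hFq : #|Fq| = q)
    (L : closedFieldType) (iota : {rmorphism Fq -> L})
    (hL : algebraic_closure_of iota)
    (psi : R -> L) (hpsi : iso_Qp'_mod_Z p psi)
    (v : 'rV[R]_n) (hv : in_Abar_p' p v) (hF : F_stable q v) :
  exists w : 'S_n,
    unique (shortest_carrying q v) w /\
    forall c : {set 'M[Fq]_n},
      corresponds iota psi v c -> is_Phi c (w ^: [set: 'S_n])%g.
Proof.
have [[v_sum0 _ _] v_Qp'] := hv.
have charL : [pchar L].-nat #|Fq|.
  rewrite (eq_pnat _ (fmorph_pchar iota)) hFq hq pnatX pnatE //.
  by rewrite (@card_finPcharP _ _ e) // hFq.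
pose phi (x : L) := x ^+ q; pose lam i := psi (v 0 i).
have phi_inj : injective phi by rewrite /phi -hFq; apply: frobenius_inj charL.
have carries_lifts w : carries q v w <-> lifts phi lam w.
  rewrite carriesP //.
  have E i : phi (lam (w i)) = lam i <-> exists m : int, q%:R * v 0 (w i) - v 0 i = m%:~R.
    by rewrite -(eq_psi hp hpsi) ?(psiMn hp hpsi) //; apply: in_Qp'Mn.
  by split=> [H|/liftsP H i]; [apply/liftsP => i|]; apply/E.
have [w0 w0_lift] : exists w0, lifts phi lam w0.
  have [w wP] := affW_equiv_coord hF.2; exists w; apply/carries_lifts/carriesP => // i.
  by have [m mE] := wP i; exists m; rewrite -mE mxE.
pose w := [arg min_(w < w0 | lifts phi lam w) perm_length w].
have [w_lift w_min] : lifts phi lam w /\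
    forall w', lifts phi lam w' -> (perm_length w <= perm_length w')%N.
  by rewrite /w; case: arg_minnP.
have w_incr := shortest_lift_increasing w_lift w_min.
exists w; split.
  split=> [|w' [/carries_lifts w'_lift w'_min]].
    by split=> [|w' /carries_lifts]; [apply/carries_lifts | apply: w_min].
  apply: increasing_lift_uniq (w_lift) (w'_lift) w_incr _.
  by apply: shortest_lift_increasing w'_lift _ => w'' /carries_lifts; apply: w'_min.
move=> c [_ c_char].
have w_root i : lam (w i) ^+ #|Fq| = lam i by rewrite hFq; apply: (liftsP _ _ _ w_lift).
have w_ret k i := @increasing_lift_return _ _ _ _ phi_inj w k i w_lift w_incr.
pose f (C : {set 'I_n}) := orbit_poly iota lam C.
pose fs := [seq f C | C <- enum (porbits w)].
have prod_fs : map_poly iota (\prod_(g <- fs) g) = \prod_i ('X - (lam i)%:P).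
  by rewrite big_map big_enum; apply: prod_orbit_poly.
(* One factorization must serve all s in the class of w; it is built from w, and s
   has the same cycle type. *)
exists (tally fs); split=> [g /c_char g_char||s].
- have -> : char_poly g = \prod_(g <- fs) g.
    by apply: (map_poly_inj iota); rewrite map_char_poly g_char prod_fs.
  apply: is_factorization_tally => _ /mapP[C + ->].
  rewrite mem_enum => /imsetP[x _ ->].
  split; first exact: orbit_poly_monic.
  exact: orbit_poly_irreducible.
- by apply/imsetP; exists w; rewrite ?inE.
case/imsetP=> u _ ->; rewrite (permPl (cycle_type_conjg w u)).
rewrite (permPr (factor_partition_tally fs)) /cycle_type /fs -map_comp.
suff -> : [seq #|(C : {set _})| | C <- enum (porbits w)] =
    [seq (size (f C)).-1 | C <- enum (porbits w)] by [].
apply/eq_in_map => C; rewrite mem_enum => /imsetP[x _ ->].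
by rewrite /f (size_orbit_poly iota charL).
Qed.
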